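(* Fix $p>0$. For $q>0$ let $X_{p,q}\sim\beta_{p,q}$ and let $Y_{p,q}=1-X_{p,q}\sim\beta_{q,p}$. For every fixed integer $N\geq0$, $$\frac1q\,H_N(Y_{p,q})\longrightarrow\bigl[B(i+j+2,p)\bigr]_{i,j=0}^{N}\qquad\text{as } q\downarrow0$$ (entrywise). The limiting matrix is strictly positive definite. In particular, for fixed $p$ and $N$, $H_N(\beta_{p,q})$ is positive definite for all sufficiently small $q>0$.
   Context: $B$ denotes the Euler beta function, $B(a,b)=\int_0^1x^{a-1}(1-x)^{b-1}\,\mathrm{d}x$. For $p,q>0$, $\beta_{p,q}$ denotes the beta distribution on $[0,1]$ with density $x^{p-1}(1-x)^{q-1}/B(p,q)$ on $(0,1)$. For a probability measure $\mu$ on $\mathbb{R}$ with finite moments $m_n(\mu)=\int x^n\,\mu(\mathrm{d}x)$, the free cumulants $\kappa_n(\mu)$, $n\ge 1$, are determined by $m_n(\mu)=\sum_{\pi\in NC(n)}\prod_{V\in\pi}\kappa_{|V|}(\mu)$ for all $n\geq 1$, where $NC(n)$ is the set of noncrossing partitions of $\{1,\dots,n\}$ and the product is over the blocks $V$ of $\pi$. For $N\ge0$, $H_N(\mu)=[\kappa_{i+j+2}(\mu)]_{i,j=0}^{N}$; for a random variable $Y$, $H_N(Y)$ means $H_N$ of the law of $Y$. *)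

(* Defs.v *)
From HB Require Import structures.
From mathcomp Require Import all_boot all_order all_algebra.
From mathcomp Require Import all_classical all_reals all_analysis.
From mathcomp Require Import measurable_realfun.

Set Implicit Arguments.
Unset Strict Implicit.
Unset Printing Implicit Defensive.

Import Order.TTheory GRing.Theory Num.Theory.
Import numFieldNormedType.Exports.

Local Open Scope classical_set_scope.
Local Open Scope ring_scope.

Definition noncrossing n (P : {set {set 'I_n}}) : bool :=
  [forall V in P, forall W in P, forall a in V, forall b in W,
     forall c in V, forall d in W, (a < b < c)%N && (c < d)%N ==> (V == W)].

Definition NC n : {set {set {set 'I_n}}} :=
  [set P : {set {set 'I_n}} | finset.partition P [set: 'I_n]%SET & noncrossing P]%SET.

Definition posdefmx (R : realType) n (A : 'M[R]_n) : Prop :=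
  A^T = A /\ forall v : 'cV[R]_n, v != 0 -> 0 < (v^T *m A *m v) 0 0.

Section free_cumulants.
Context {R : realType}.

Definition moment_cumulant (m k : nat -> R) : Prop :=
  forall n, (0 < n)%N -> m n = \sum_(P in NC n) \prod_(V in P) k #|V|.

Definition moment (mu : {measure set (measurableTypeR R) -> \bar R}) (n : nat) : R :=
  \int[mu]_x (x ^+ n).

(* The moment-cumulant formula does not involve the value at 0, which is
   normalised to 0; existence and uniqueness are moment_free_cumulant and
   free_cumulant_unique below. *)
Definition free_cumulant (mu : {measure set (measurableTypeR R) -> \bar R}) :
    nat -> R :=
  xget (fun=> 0) [set k | k 0%N = 0 /\ moment_cumulant (moment mu) k].

Lemma NC_setT n : [set [set: 'I_n.+1]]%SET \in NC n.+1.
Proof.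
rewrite inE; apply/andP; split; last first.
  apply/forall_inP => V /set1P ->; apply/forall_inP => W /set1P ->.
  by do 4![apply/forall_inP => ? _]; rewrite eqxx implybT.
rewrite /finset.partition /finset.cover big_set1 eqxx /=; apply/andP; split.
  by apply/finset.trivIsetP => A B /set1P -> /set1P ->; rewrite eqxx.
by rewrite inE eq_sym -card_gt0 cardsT card_ord.
Qed.

Lemma card_NC_block n (P : {set {set 'I_n.+1}}) (V : {set 'I_n.+1}) :
  P \in NC n.+1 -> P != [set [set: 'I_n.+1]]%SET -> V \in P -> (#|V| <= n)%N.
Proof.
rewrite inE => /andP[/and3P[/eqP cov tri n0] _] piT Vpi.
have [VT|VT] := eqVneq V [set: 'I_n.+1]%SET; last first.
  have : (#|V| < #|[set: 'I_n.+1]%SET|)%N by rewrite proper_card// properT.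
  by rewrite cardsT card_ord ltnS.
case/eqP: piT; apply/setP => W; rewrite inE; apply/idP/eqP => [Wpi|->]; last by rewrite -VT.
apply/eqP; rewrite -VT; apply: contraT => WV.
have := finset.trivIsetP tri _ _ Wpi Vpi WV.
rewrite VT -setI_eq0 finset.setIT => /eqP W0.
by case/negP: n0; rewrite -W0.
Qed.

Lemma NC_sumE (k : nat -> R) n :
  \sum_(P in NC n.+1) \prod_(V in P) k #|V| =
  k n.+1 + \sum_(P in NC n.+1 | P != [set [set: 'I_n.+1]]%SET)
             \prod_(V in P) k #|V|.
Proof.
by rewrite (bigD1 [set [set: 'I_n.+1]]%SET) ?NC_setT//= big_set1 cardsT card_ord.
Qed.

Let cumulants (m : nat -> R) : nat -> seq R :=
  fix cumulants n := if n is n'.+1 then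
    rcons (cumulants n')
      (m n - \sum_(P in NC n | P != [set [set: 'I_n]]%SET)
               \prod_(V in P) nth 0 (cumulants n') #|V|)
  else [:: 0].

Let size_cumulants m n : size (cumulants m n) = n.+1.
Proof. by elim: n => //= n IH; rewrite size_rcons IH. Qed.

Let nth_cumulants m n j : (j <= n)%N ->
  nth 0 (cumulants m n) j = nth 0 (cumulants m j) j.
Proof.
elim: n => [|n IH]; first by rewrite leqn0 => /eqP ->.
rewrite leq_eqVlt => /predU1P[->//|jn] /=.
by rewrite nth_rcons size_cumulants jn IH.
Qed.

Lemma moment_cumulant_exists (m : nat -> R) :
  exists k, k 0%N = 0 /\ moment_cumulant m k.
Proof.
pose k n := nth 0 (cumulants m n) n; exists k; split=> // -[//|n] _.
rewrite NC_sumE {1}/k /= nth_rcons size_cumulants ltnn eqxx -[LHS]addr0.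
rewrite -addrA; congr (_ + _); apply/esym/eqP; rewrite addrC subr_eq0; apply/eqP.
apply: eq_bigr => P /andP[PNC PT]; apply: eq_bigr => V VP.
by rewrite nth_cumulants// (card_NC_block PNC PT).
Qed.

Lemma moment_cumulant_unique (m k k' : nat -> R) :
  moment_cumulant m k -> moment_cumulant m k' ->
  forall n, (0 < n)%N -> k n = k' n.
Proof.
move=> mk mk'; elim/ltn_ind => -[//|n] IH _.
have := mk n.+1 isT; rewrite (mk' n.+1 isT) !NC_sumE => /esym/eqP.
rewrite -subr_eq0 opprD addrACA addrC (_ : _ - _ = 0) ?add0r ?subr_eq0; first by move/eqP.
apply/eqP; rewrite subr_eq0; apply/eqP; apply: eq_bigr => P /andP[piNC piT].
apply: eq_bigr => V Vpi; apply: IH; first by rewrite ltnS (card_NC_block piNC piT).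
rewrite card_gt0; apply: contraTneq Vpi => ->.
by move: piNC; rewrite inE => /andP[/and3P[]].
Qed.

Lemma moment_free_cumulant mu : moment_cumulant (moment mu) (free_cumulant mu).
Proof.
rewrite /free_cumulant; case: xgetP => [k _ [_ //]|] noP.
by have [k kP] := moment_cumulant_exists (moment mu); case: (noP k).
Qed.

Lemma free_cumulant_unique mu (k : nat -> R) :
  moment_cumulant (moment mu) k -> forall n, (0 < n)%N -> k n = free_cumulant mu n.
Proof. by move/moment_cumulant_unique; apply; exact: moment_free_cumulant. Qed.

Definition cumulant_hankel N (mu : {measure set (measurableTypeR R) -> \bar R}) :
    'M[R]_N.+1 :=
  \matrix_(i, j) free_cumulant mu (i + j + 2).

End free_cumulants.

Section beta.
Context {R : realType}.
Local Notation mu := (@lebesgue_measure R).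

Definition beta_weight (a b x : R) : R := x `^ (a - 1) * (1 - x) `^ (b - 1).

Definition euler_beta (a b : R) : R :=
  \int[mu]_(x in `]0, 1[) beta_weight a b x.

Definition beta_density (p q x : R) : R :=
  (beta_weight p q \_ `]0, 1[) x / euler_beta p q.

(* A probability measure when 0 < p and 0 < q; otherwise the normalising
   integral diverges and its value, hence the measure, is a junk one. *)
Definition beta_dist (p q : R) (A : set (measurableTypeR R)) : \bar R :=
  (\int[mu]_(x in A) (beta_density p q x)%:E)%E.

Lemma beta_weight_ge0 a b x : 0 <= beta_weight a b x.
Proof. by rewrite mulr_ge0// powR_ge0. Qed.

Lemma euler_beta_ge0 a b : 0 <= euler_beta a b.
Proof. by apply: Rintegral_ge0 => // x _; exact: beta_weight_ge0. Qed.

Lemma beta_density_ge0 p q x : 0 <= beta_density p q x.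
Proof.
rewrite divr_ge0 ?euler_beta_ge0// patchE.
by case: ifPn => // _; exact: beta_weight_ge0.
Qed.

Lemma measurable_beta_density p q : measurable_fun setT (beta_density p q).
Proof.
apply: measurable_funM => //.
apply/(measurable_restrictT _ _).1 => //.
apply: measurable_funTS; apply: measurable_funM => //.
apply: (measurableT_comp (measurable_powR _)).
exact: measurable_funB.
Qed.

Section beta_measure.
Variables p q : R.

Let beta_dist0 : beta_dist p q set0 = 0%E.
Proof. by rewrite /beta_dist integral_set0. Qed.

Let beta_dist_ge0 A : (0 <= beta_dist p q A)%E.
Proof. by apply: integral_ge0 => x _; rewrite lee_fin beta_density_ge0. Qed.

Let beta_dist_sigma_additive : semi_sigma_additive (beta_dist p q).
Proof.
move=> /= F mF tF mUF; rewrite /beta_dist; apply: cvg_toP.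
  apply: ereal_nondecreasing_is_cvgn => m n mn.
  apply: lee_sum_nneg_natr => // k _ _; apply: integral_ge0 => /= x Fkx.
  by rewrite lee_fin beta_density_ge0.
rewrite ge0_integral_bigcup//=.
- apply/measurable_funTS/measurableT_comp => //.
  exact: measurable_beta_density.
- by move=> x _; rewrite lee_fin beta_density_ge0.
Qed.

HB.instance Definition _ := isMeasure.Build _ _ _ (beta_dist p q)
  beta_dist0 beta_dist_ge0 beta_dist_sigma_additive.

End beta_measure.
End beta.

(* Main.v *)
Require Import Defs.
From HB Require Import structures.
From mathcomp Require Import all_boot all_order all_algebra.

(** Write [Y = 1 - X], so that [Y] has law [beta_{q,p}] and its moments are
    [B(q+n,p) / B(q,p)].  Since [q B(q,p) = (q+p) B(q+1,p)], the rescaled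
    moments [m_n(Y) / q] converge to [B(n,p)] as [q] decreases to [0].  In the
    moment-cumulant formula every partition with at least two blocks contributes
    [O(q^2)], hence [kappa_n(Y) / q] has the same limit.  The limiting Hankel
    matrix is the Gram matrix of the monomials for the weight [x (1-x)^(p-1)] on
    [(0,1)], so it is positive definite, and positive definiteness is an open
    condition by compactness of the unit sphere.  Finally
    [kappa_n(1-Y) = (-1)^n kappa_n(Y)] for [n >= 2], so that [H_N(X)] and
    [H_N(Y)] are congruent by a diagonal sign matrix. *)

Set Implicit Arguments.
Unset Strict Implicit.
Unset Printing Implicit Defensive.

Import Order.TTheory GRing.Theory Num.Theory.

Local Open Scope ring_scope.

(** * Translation of free cumulants *)

Lemma noncrossingP k (P : {set {set 'I_k}}) :
  reflect (forall V W a b c d, V \in P -> W \in P -> a \in V -> b \in W ->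
             c \in V -> d \in W -> (a < b < c)%N -> (c < d)%N -> V = W)
          (noncrossing P).
Proof.
apply: (iffP idP) => [ncP V W a b c d VP WP aV bW cV dW abc cd|ncP].
  move/forall_inP : ncP => /(_ _ VP)/forall_inP/(_ _ WP)/forall_inP/(_ _ aV).
  move=> /forall_inP/(_ _ bW)/forall_inP/(_ _ cV)/forall_inP/(_ _ dW).
  by rewrite abc cd => /eqP.
apply/forall_inP => V VP; apply/forall_inP => W WP; apply/forall_inP => a aV.
apply/forall_inP => b bW; apply/forall_inP => c cV; apply/forall_inP => d dW.
by apply/implyP => /andP[abc cd]; apply/eqP; exact: (ncP V W a b c d).
Qed.

(** * Noncrossing partitions with prescribed singleton blocks *)

Section noncrossing_restriction.
Variables (m n : nat) (h : 'I_m -> 'I_n) (B : {set 'I_n}).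
Hypothesis h_mono : {mono h : i j / (i < j)%N}.
Hypothesis h_im : h @: [set: 'I_m]%SET = ~: B.

Let singletons : {set {set 'I_n}} := [set [set x] | x in B]%SET.

(** The increasing map [h] enumerates the complement of [B]. Inserting the points of [B] as
    singleton blocks creates no crossing, since a crossing needs two points in each of its blocks.
    With inverse [restrict], this is a bijection from [NC m] onto the members of [NC n] that contain
    [singletons]. *)
Let add_singletons (Q : {set {set 'I_m}}) : {set {set 'I_n}} :=
  ([set h @: (V : {set 'I_m}) | V in Q] :|: singletons)%SET.

Let restrict (P : {set {set 'I_n}}) : {set {set 'I_m}} :=
  [set h @^-1: (V : {set 'I_n}) | V in P :\: singletons]%SET.

Let h_inj : injective h.
Proof.
move=> i j hij; apply/val_inj; case: (ltngtP i j) => // ij.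
  by move: (h_mono i j); rewrite hij ltnn ij.
by move: (h_mono j i); rewrite hij ltnn ij.
Qed.

Let h_notin i : h i \notin B.
Proof. by rewrite -in_setC -h_im imset_f ?inE. Qed.

Let h_onto x : x \notin B -> exists i, x = h i.
Proof. by rewrite -in_setC -h_im => /imsetP[i _ ->]; exists i. Qed.

Let imset_notin_singletons (V : {set 'I_m}) : (h @: V)%SET \notin singletons.
Proof.
apply/imsetP => -[x xB /setP/(_ x)]; rewrite set11 => /imsetP[i _ xE].
by have := h_notin i; rewrite -xE xB.
Qed.

Let imsetK_inj (V : {set 'I_m}) : (h @^-1: (h @: V) = V)%SET.
Proof. by apply/setP => i; rewrite !inE mem_imset. Qed.

Let add_singletonsK Q : restrict (add_singletons Q) = Q.
Proof.
rewrite /restrict /add_singletons setDUl setDv setU0.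
apply/setP => V; apply/imsetP/idP => [[W /setDP[/imsetP[U UQ ->] _] ->]|VQ].
  by rewrite imsetK_inj.
exists (h @: V)%SET; last by rewrite imsetK_inj.
by rewrite inE imset_notin_singletons imset_f.
Qed.

Let singletons_sub Q : singletons \subset add_singletons Q.
Proof. exact: subsetUr. Qed.

(** A block of [P] outside [singletons] is disjoint from every [[set x]] with [x] in [B], so it lies
    in the image of [h] and is recovered from its preimage. *)
Let restrictK P : P \in NC n -> singletons \subset P ->
  add_singletons (restrict P) = P.
Proof.
rewrite inE => /andP[/and3P[_ /trivIsetP tri _] _] /subsetP sP.
rewrite /add_singletons; apply/setP => V; rewrite in_setU; apply/orP/idP.
- case=> [/imsetP[_ /imsetP[W /setDP[WP Ws] ->] ->]|/sP//].
  suff -> : (h @: (h @^-1: W) = W)%SET by [].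
  apply/setP => x; apply/imsetP/idP => [[i]|xW]; first by rewrite inE => ? ->.
  have [xB|/h_onto[i xE]] := boolP (x \in B); last by exists i; rewrite // inE -xE.
  have xs : [set x]%SET \in singletons by apply: imset_f.
  have /(tri _ _ WP (sP _ xs)) : W != [set x]%SET by apply: contraNneq Ws => ->.
  by rewrite disjoint_sym disjoints1 xW.
- move=> VP; have [|Vs] := boolP (V \in singletons); [by right|left].
  have VE : (V = h @: (h @^-1: V))%SET.
    apply/setP => x; apply/idP/imsetP => [xV|[i]]; last by rewrite inE => ? ->.
    have [xB|/h_onto[i xE]] := boolP (x \in B); last by exists i; rewrite // inE -xE.
    have xs : [set x]%SET \in singletons by apply: imset_f.
    have /(tri _ _ VP (sP _ xs)) : V != [set x]%SET by apply: contraNneq Vs => ->.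
    by rewrite disjoint_sym disjoints1 xV.
  rewrite {1}VE; apply: imset_f; apply: imset_f.
  by rewrite inE Vs.
Qed.

Let cover_singletons : cover singletons = B.
Proof.
apply/setP => x; apply/bigcupP/idP => [[_ /imsetP[y yB ->]]|xB].
  by rewrite inE => /eqP ->.
by exists [set x]%SET; rewrite ?set11// imset_f.
Qed.

Let partition_add_singletons Q :
  partition (add_singletons Q) [set: 'I_n]%SET = partition Q [set: 'I_m]%SET.
Proof.
rewrite -(imset_partition Q _ h_inj) h_im.
set hQ := [set h @: (V : {set 'I_m}) | V in Q]%SET.
have hQs V : V \in hQ -> V \notin singletons.
  by move=> /imsetP[W _ ->]; exact: imset_notin_singletons.
have hQB V x : V \in hQ -> x \in V -> x \notin B.
  by move=> /imsetP[W _ ->] /imsetP[i _ ->]; exact: h_notin.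
apply/and3P/and3P => -[/eqP cov /trivIsetP tri n0]; split.
- apply/eqP/setP => x; rewrite inE; apply/bigcupP/idP => [[V VhQ xV]|xB].
    exact: (hQB V).
  have : x \in cover (add_singletons Q) by rewrite cov inE.
  case/bigcupP => V /setUP[VhQ xV|]; first by exists V.
  by move=> /imsetP[y yB ->] /set1P xy; rewrite xy yB in xB.
- by apply/trivIsetP => V W VQ WQ; apply: tri; rewrite inE ?VQ ?WQ.
- by apply: contraNN n0; rewrite inE => ->.
- rewrite /cover bigcup_setU -/(cover hQ) -/(cover singletons) cov.
  by rewrite cover_singletons setUC setUCr.
- have disj V y : V \in hQ -> y \in B -> [disjoint V & [set y]].
    by move=> VQ yB; rewrite disjoint_sym disjoints1; apply: contraTN yB; exact: hQB.
  apply/trivIsetP => V W /setUP[VQ|/imsetP[x xB ->]] /setUP[WQ|/imsetP[y yB ->]] VW.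
  + exact: tri.
  + exact: disj.
  + by rewrite disjoint_sym disj.
  + by rewrite disjoints1 inE; apply: contraNneq VW => ->.
- rewrite inE negb_or n0 /=; apply/imsetP => -[x _ /setP/(_ x)].
  by rewrite !inE eqxx.
Qed.

Let noncrossing_add_singletons Q :
  noncrossing (add_singletons Q) = noncrossing Q.
Proof.
apply/noncrossingP/noncrossingP => nc V W a b c d.
- move=> VQ WQ aV bW cV dW abc cd; apply: (imset_inj h_inj).
  apply: (nc _ _ (h a) (h b) (h c) (h d)).
  - by rewrite inE imset_f.
  - by rewrite inE imset_f.
  - by rewrite imset_f.
  - by rewrite imset_f.
  - by rewrite imset_f.
  - by rewrite imset_f.
  - by rewrite !h_mono.
  - by rewrite h_mono.
move=> /setUP[|/imsetP[x _ ->]]; last first.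
  by move=> _ /set1P -> _ /set1P -> _ /andP[/ltn_trans/[apply]]; rewrite ltnn.
move=> /imsetP[V' VQ ->] /setUP[|/imsetP[x _ ->]]; last first.
  move=> _ /set1P -> _ /set1P -> /andP[_ /ltn_trans/[apply]].
  by rewrite ltnn.
move=> /imsetP[W' WQ ->] /imsetP[a' aV ->] /imsetP[b' bW ->] /imsetP[c' cV ->].
move=> /imsetP[d' dW ->]; rewrite !h_mono => abc cd.
by rewrite (nc V' W' a' b' c' d').
Qed.

Lemma sum_NC_singletons (K : comNzRingType) (k : nat -> K) :
  \sum_(P in NC n | [set [set x] | x in B]%SET \subset P)
     \prod_(V in P :\: [set [set x] | x in B]%SET) k #|V| =
  \sum_(Q in NC m) \prod_(V in Q) k #|V|.
Proof.
rewrite (reindex_onto add_singletons restrict) => [|P /andP[]]; last exact: restrictK.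
apply: eq_big => [Q|Q _].
  rewrite singletons_sub andbT add_singletonsK eqxx andbT !inE.
  by rewrite partition_add_singletons noncrossing_add_singletons.
(* Seen as [restrict (add_singletons Q)], the index [Q] is an image under preimage by [h], and both
   products run over the blocks outside [singletons]. *)
rewrite -{2}(add_singletonsK Q) big_imset/= => [|V W].
  rewrite [RHS]big_mkcond [LHS]big_mkcond/=; apply: eq_bigr => V _; case: ifP => //.
  rewrite inE /add_singletons inE => /andP[/negPf ->]; rewrite orbF => /imsetP[U _ ->].
  by rewrite imsetK_inj card_imset.
have hh U : U \in add_singletons Q :\: singletons -> (h @: (h @^-1: U) = U)%SET.
  rewrite inE /add_singletons inE => /andP[/negPf ->].
  by rewrite orbF => /imsetP[U' _ ->]; rewrite imsetK_inj.
by move=> /hh VE /hh WE hVW; rewrite -VE hVW WE.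
Qed.
End noncrossing_restriction.

(** * Adding a constant to the first cumulant *)

Lemma sum_subsets_card (K : nzRingType) (T : finType) (f : nat -> K) :
  \sum_(B : {set T}) f #|B| = \sum_(j < #|T|.+1) f j *+ 'C(#|T|, j).
Proof.
rewrite (partition_big (fun B : {set T} => inord #|B| : 'I_#|T|.+1) xpredT)//=.
apply: eq_bigr => j _; rewrite -card_draws -sumr_const.
apply: eq_big => [B|B]; first by rewrite inE -val_eqE /= inordK ?ltnS ?max_card.
by move=> /eqP <-; rewrite inordK ?ltnS ?max_card.
Qed.

(** Expanding the product picks one summand per block. The summand [c] is available only at
    singleton blocks, so a choice amounts to the set [B] of points whose singletons take [c]. *)
Lemma prod_add_singletons (K : comNzRingType) (k : nat -> K) (c : K) (T : finType)
    (P : {set {set T}}) :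
  \prod_(V in P) (k #|V| + c *+ (#|V| == 1)) =
  \sum_(B : {set T} | [set [set x] | x in B] \subset P)
     c ^+ #|B| * \prod_(V in P :\: [set [set x] | x in B]) k #|V|.
Proof.
(* With values [0] and [1] off [P], the product extends to all subsets of [T], where [bigA_distr]
   applies. *)
pose F (V : {set T}) := if V \in P then c *+ (#|V| == 1) else 0.
pose G (V : {set T}) := if V \in P then k #|V| else 1.
transitivity (\prod_V (F V + G V)).
  rewrite big_mkcond; apply: eq_bigr => V _; rewrite /F /G.
  by case: ifP => _; [rewrite addrC|rewrite add0r].
rewrite bigA_distr (bigID [pred J : {set {set T}} |
  (J \subset P) && [forall V in J, #|V| == 1]]) /= [X in _ + X]big1 ?addr0; last first.
  move=> J; rewrite negb_and => /orP[/subsetPn[V VJ VP]|].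
    by rewrite (bigD1 V)//= VJ /F (negPf VP) mul0r.
  case/forall_inPn => V VJ V1; rewrite (bigD1 V)//= VJ /F.
  by case: ifP => _; rewrite ?(negPf V1) ?mulr0n mul0r.
rewrite (reindex_onto (fun B : {set T} => [set [set x] | x in B])
          (fun J => [set x | [set x] \in J])) /=; last first.
  move=> J /andP[_ /forall_inP J1]; apply/setP => V; apply/imsetP/idP.
    by move=> [x]; rewrite inE => xJ ->.
  move=> VJ; have /cards1P[x VE] := J1 _ VJ.
  by exists x => //; rewrite inE -VE.
have sK (B : {set T}) : [set x | [set x] \in [set [set x] | x in B]] = B.
  by apply/setP => x; rewrite inE mem_imset//; exact: set1_inj.
apply: eq_big => [B|B /andP[/andP[BP _] _]].
  rewrite sK eqxx andbT; case: (_ \subset P) => //=.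
  by apply/forall_inP => _ /imsetP[x _ ->]; rewrite cards1.
rewrite (bigID (mem [set [set x] | x in B]))/=; congr (_ * _).
  rewrite -(card_imset (mem B) set1_inj) -prodr_const; apply: eq_bigr => V VB.
  rewrite VB /F (subsetP BP _ VB).
  by move: VB => /imsetP[x _ ->]; rewrite cards1.
rewrite big_mkcond [RHS]big_mkcond; apply: eq_bigr => V _; rewrite inE /G.
by case: (_ \in _) => //=; case: ifP.
Qed.

(** This is the binomial formula for the moments of a translate by [c]. Once the set [B] of
    singletons carrying [c] is fixed, the other blocks form a noncrossing partition of its
    complement. *)
Lemma sum_NC_add_singletons (K : comNzRingType) (k : nat -> K) (c : K) n :
  \sum_(P in NC n) \prod_(V in P) (k #|V| + c *+ (#|V| == 1)) =
  \sum_(j < n.+1)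
    (c ^+ j * \sum_(P in NC (n - j)) \prod_(V in P) k #|V|) *+ 'C(n, j).
Proof.
under eq_bigr do rewrite prod_add_singletons.
rewrite (exchange_big_dep xpredT)//=.
pose S B := \sum_(P in NC (n - B)) \prod_(V in P) k #|V|.
have := sum_subsets_card 'I_n (fun j => c ^+ j * S j).
rewrite card_ord => <-; apply: eq_bigr => B _.
rewrite -mulr_sumr {}/S; congr (_ * _).
have -> : (n - #|B|)%N = #|~: B|.
  by have nE := cardsC B; rewrite card_ord in nE; rewrite -[X in (X - _)%N]nE addKn.
(* The increasing enumeration of the complement of [B] serves as [h]. *)
rewrite -(@sum_NC_singletons _ _ (@Order.enum_val _ 'I_n (mem (~: B))) B)//.
  move=> i j; have := @Order.le_enum_val _ 'I_n _ (mem (~: B)) j i.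
  by rewrite !leEord !ltnNge => ->//; exact: leq_total.
apply/setP => x; apply/imsetP/idP => [[i _ ->]|xB].
  by have := Order.enum_valP i.
by exists (Order.enum_rank_in xB x); rewrite // Order.enum_rankK_in.
Qed.

From mathcomp Require Import all_classical all_reals all_analysis.
From mathcomp Require Import measurable_realfun ring lra.

Import Order.TTheory GRing.Theory Num.Theory.
Import numFieldNormedType.Exports.

Local Open Scope classical_set_scope.
Local Open Scope ring_scope.

(** * Cumulants under reflection and under rescaling *)

Lemma sum_NC0 (K : comNzRingType) (k : nat -> K) :
  \sum_(P in NC 0) \prod_(V in P) k #|V| = 1.
Proof.
have P0 (P : {set {set 'I_0}}) : (P \in NC 0) = (P == finset.set0).
  rewrite inE; have -> : [set: 'I_0]%SET = finset.set0 by apply/setP => -[].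
  rewrite finset.partition_set0; apply/andP/eqP => [[/eqP]//|->]; split => //.
  by apply/forall_inP => V; rewrite inE.
by rewrite (big_pred1 finset.set0) ?big_set0.
Qed.

(** Here [m'] are the moments of [1 - Y] when [m] are those of [Y]. The reflection contributes the
    signs, and the translation by [1] changes the first cumulant only. *)
Lemma moment_cumulant_onem (R : realType) (m m' k : nat -> R) :
  m 0%N = 1 -> moment_cumulant m k ->
  (forall n, m' n = \sum_(j < n.+1) ((-1) ^+ (n - j) * m (n - j)%N) *+ 'C(n, j)) ->
  moment_cumulant m' (fun n => (-1) ^+ n * k n + (n == 1%N)%:R).
Proof.
move=> m0 mk m'E n n0.
rewrite (sum_NC_add_singletons (fun i => (-1) ^+ i * k i)) m'E.
apply: eq_bigr => j _; rewrite expr1n mul1r; congr (_ *+ _).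
(* The relation [moment_cumulant] says nothing at order 0; there [m0] matches the sum over the empty
   partition. *)
have [->|nj0] := posnP (n - j).
  by rewrite expr0 mul1r m0 (sum_NC0 (fun i => (-1) ^+ i * k i)).
rewrite (mk _ nj0) mulr_sumr; apply: eq_bigr => P.
(* The block sizes add up to [n - j], so the sign distributes over the blocks. *)
rewrite inE => /andP[/finset.card_partition + _]; rewrite cardsT card_ord => {1}->.
by rewrite -prodrXr -big_split.
Qed.

Lemma free_cumulant_onem (R : realType)
    (mu nu : {measure set (measurableTypeR R) -> \bar R}) n :
  moment mu 0%N = 1 ->
  (forall i, moment nu i =
    \sum_(j < i.+1) ((-1) ^+ (i - j) * moment mu (i - j)%N) *+ 'C(i, j)) ->
  (1 < n)%N -> free_cumulant nu n = (-1) ^+ n * free_cumulant mu n.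
Proof.
move=> mu0 nuE n1.
have /free_cumulant_unique <- := moment_cumulant_onem mu0 (moment_free_cumulant mu) nuE.
  by rewrite gtn_eqF// addr0.
exact: ltnW.
Qed.

(** Strong induction: the moment and the cumulant of order [n.+1] differ by a sum over partitions
    with at least two blocks, which involves only cumulants of order at most [n]. *)
Lemma cvg_free_cumulant_scaled (R : realType) (m k : R -> nat -> R) (L : nat -> R) :
  (forall q, 0 < q -> moment_cumulant (m q) (k q)) ->
  (forall n, (0 < n)%N -> q^-1 * m q n @[q --> 0^'+] --> L n) ->
  forall n, (0 < n)%N -> q^-1 * k q n @[q --> 0^'+] --> L n.
Proof.
move=> mk mL; elim/ltn_ind => -[//|n] IH _.
pose S q := \sum_(P in NC n.+1 | P != [set [set: 'I_n.+1]]%SET)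
  q^-1 * \prod_(V in P) k q #|V|.
have kE : {near 0^'+, (fun q => q^-1 * m q n.+1 - S q) =1 (fun q => q^-1 * k q n.+1)}.
  near=> q; rewrite /S -mulr_sumr -mulrBr (mk q)// NC_sumE.
  by rewrite addrK.
apply: cvg_trans (near_eq_cvg kE) _.
rewrite -[L _]subr0; apply: cvgB; first exact: mL.
suff : S q @[q --> 0^'+] -->
    \sum_(P in NC n.+1 | P != [set [set: 'I_n.+1]]%SET) (0 : R) by rewrite big1.
apply: cvg_big => [|P /andP[PNC PT]]; first exact: add_continuous.
have k0 j : (0 < j <= n)%N -> k q j @[q --> 0^'+] --> 0.
  move=> /andP[j0 jn]; have kE' : {near 0^'+, (fun q => q * (q^-1 * k q j)) =1 k^~ j}.
    by near=> q; rewrite mulrA divff ?mul1r.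
  apply: cvg_trans (near_eq_cvg kE') _.
  suff : q * (q^-1 * k q j) @[q --> 0^'+] --> 0 * L j by rewrite mul0r.
  apply: cvgM; last exact: IH.
  by apply: (@cvg_at_right_filter _ _ id); exact: cvg_id.
have Pcard V : V \in P -> (0 < #|V| <= n)%N.
  move=> VP; rewrite (card_NC_block PNC PT VP) andbT card_gt0.
  by move: PNC; rewrite inE => /andP[/finset.partition_neq0/(_ VP)].
(* Two distinct blocks [V] and [W]: the factor of [V] absorbs [q^-1], while that
   of [W] tends to 0. *)
have [V VP [W WP WV]] : exists2 V, V \in P & exists2 W, W \in P & W != V.
  have /andP[Ppart _] : finset.partition P [set: 'I_n.+1]%SET && noncrossing P.
    by move: PNC; rewrite inE.
  have : ord0 \in finset.cover P by rewrite (finset.cover_partition Ppart) inE.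
  case/finset.bigcupP => V VP _; exists V => //.
  (* Were [V] the only block, it would be the whole set, against [PT]. *)
  apply/exists_inP; apply: contraNT PT => /exists_inPn noW.
  have PV : P = [set V]%SET.
    apply/setP => W; rewrite inE; apply/idP/eqP => [/noW|->//].
    by rewrite negbK => /eqP.
  by rewrite PV -(finset.cover_partition Ppart) PV finset.cover1.
suff : (q^-1 * k q #|V|) * \prod_(U in P | U != V) k q #|U| @[q --> 0^'+]
    --> L #|V| * \prod_(U in P | U != V) (0 : R).
  rewrite [X in _ * X](bigD1 W) ?WP//= mul0r mulr0.
  by under eq_fun do rewrite -mulrA -(bigD1 V)//.
apply: cvgM; first by have /andP[? ?] := Pcard _ VP; exact: IH.
apply: cvg_big => [|U /andP[UP _]]; first exact: mul_continuous.
exact/k0/Pcard.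
Unshelve. all: by end_near. Qed.

(** * Positive definite matrices *)

Lemma quad_formE (R : realType) n (A : 'M[R]_n) (v : 'cV[R]_n) :
  (v^T *m A *m v) 0 0 = \sum_i \sum_j v i 0 * A i j * v j 0.
Proof.
rewrite mxE exchange_big; apply: eq_bigr => j _; rewrite mxE mulr_suml.
by apply: eq_bigr => i _; rewrite mxE.
Qed.

Lemma posdefmxZ (R : realType) n (A : 'M[R]_n) c :
  0 < c -> posdefmx A -> posdefmx (c *: A).
Proof.
move=> c0 [AT Apos]; split=> [|v v0]; first by rewrite linearZ /= AT.
by rewrite -scalemxAr -scalemxAl mxE mulr_gt0// Apos.
Qed.

(** The quadratic form converges jointly in the vector and along [F], hence is positive near each
    unit vector; compactness makes this uniform over the sphere [K], and homogeneity of degree 2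
    extends it to all nonzero vectors. *)
Lemma near_posdefmx (R : realType) n (T : Type) (F : set_system T) {FF : Filter F}
    (A : T -> 'M[R]_n) (A0 : 'M[R]_n) :
  (forall i j, A x i j @[x --> F] --> A0 i j) -> posdefmx A0 ->
  (\forall x \near F, (A x)^T = A x) -> \forall x \near F, posdefmx (A x).
Proof.
move=> AA0 [_ A0pos] Asym.
pose K : set 'rV[R]_n := [set u | `|u| = 1].
have cK : compact K.
  apply: bounded_closed_compact.
    by exists 1; split=> // y y1 u /= ->; exact: ltW.
  apply: (@preimage_closed _ _ (fun u : 'rV[R]_n => `|u|) [set 1]) => [u _|].
    exact: norm_continuous.
  exact: closed_eq.
pose f (p : 'rV[R]_n * T) := \sum_i \sum_j p.1 0 i * A p.2 i j * p.1 0 j.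
have /compact_near_coveringP/(_ _ F (fun x u => 0 < f (u, x)) FF) := cK.
have fK u : K u -> \forall u' \near u & x \near F, 0 < f (u', x).
  move=> Ku; have u0 : u^T != 0.
    rewrite trmx_eq0; apply: contraPneq Ku => ->.
    by rewrite /K /= normr0 => /esym/eqP; rewrite oner_eq0.
  have := A0pos _ u0; rewrite quad_formE => Qpos.
  have fcvg : f p @[p --> filter_prod (nbhs u) F] -->
      \sum_i \sum_j u^T i 0 * A0 i j * u^T j 0.
    apply: cvg_big => [|i _]; first exact: add_continuous.
    apply: cvg_big => [|j _]; first exact: add_continuous.
    have cu k : (fun p : 'rV[R]_n * T => p.1 0 k) @ filter_prod (nbhs u) F --> u^T k 0.
      rewrite mxE; have /= ck := @coord_continuous R 1 n 0 k u.
      apply: (@cvg_comp _ _ _ fst (fun M : 'rV[R]_n => M 0 k) _ (nbhs u)); last exact: ck.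
      exact: cvg_fst.
    apply: cvgM => //; apply: cvgM => //.
    apply: (@cvg_comp _ _ _ snd (fun x => A x i j) _ F); last exact: AA0.
    exact: cvg_snd.
  exact: (cvgr_gt _ fcvg _ Qpos).
move=> /(_ fK); apply: filter_app; near=> x => fx.
split=> [|v v0]; first by near: x.
rewrite quad_formE; set w := v^T.
have w0 : 0 < `|w| by rewrite normr_gt0 trmx_eq0.
have /fx : K (`|w|^-1 *: w).
  by rewrite /K/= normrZ ger0_norm ?invr_ge0 ?normr_ge0// mulVf// gt_eqF.
have -> : f (`|w|^-1 *: w, x) = (`|w|^-1) ^+ 2 * \sum_i \sum_j v i 0 * A x i j * v j 0.
  rewrite /f mulr_sumr; apply: eq_bigr => i _; rewrite mulr_sumr; apply: eq_bigr => j _.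
  by rewrite !mxE expr2; ring.
by rewrite pmulr_rgt0// exprn_gt0// invr_gt0.
Unshelve. all: by end_near. Qed.

(** * The beta integral *)

Section open_unit_interval.
Context {R : realType}.
Local Notation mu := (@lebesgue_measure R).

(** The offset 3 keeps [a n] at most [3^-1], so that [[a n, 1 - a n]] is nondegenerate already for
    [n = 0]. *)
Let a n : R := n.+3%:R^-1.

Let a_gt0 n : 0 < a n. Proof. by rewrite invr_gt0. Qed.

Let a_le n : a n <= 3^-1. Proof. by rewrite lef_pV2 ?posrE// ler_nat. Qed.

Let a_lt n : a n < 1 - a n.
Proof. by have := a_le n; lra. Qed.

Let a_nincr n m : (n <= m)%N -> a m <= a n.
Proof. by move=> nm; rewrite lef_pV2 ?posrE// ler_nat. Qed.

Let a_cvg0 : a n @[n --> \oo] --> 0.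
Proof.
have := @cvg_harmonic R; rewrite -(cvg_shiftn 2).
suff -> : [sequence harmonic (n + 2)%N]_n = a by [].
by apply/funext => n; rewrite /= addn2.
Qed.

Let J n := `[a n, 1 - a n]%classic.

Let J_sub n : J n `<=` `]0, 1[.
Proof.
move=> x; rewrite /J /= !in_itv /= => /andP[ax xa].
by rewrite (lt_le_trans (a_gt0 n) ax) (le_lt_trans xa)// ltrBlDr ltrDl.
Qed.

Let J_nondecreasing : nondecreasing_seq J.
Proof.
move=> n m nm; apply/subsetPset => x; rewrite /J /= !in_itv/= => /andP[ax xa].
by have := a_nincr nm; lra.
Qed.

Let bigcup_J : \bigcup_n J n = `]0, 1[%classic.
Proof.
apply/seteqP; split=> [x [n _ /J_sub//]|x]; rewrite /= in_itv /= => /andP[x0 x1].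
have e0 : 0 < Num.min x (1 - x) by rewrite lt_min x0 subr_gt0.
have /cvgr_lt/(_ _ e0)[n _ /(_ n (leqnn n)) /=] := a_cvg0.
by rewrite lt_min => /andP[anx an1]; exists n; rewrite // /J /= in_itv /=; lra.
Qed.

(* With two nonnegative integrands and extended-real integrals nothing has to be
   integrable beforehand: the lemma yields both the finiteness of the beta
   integral and its functional equation. *)
Lemma integral_itvoo_derivative (g1 g2 F : R -> R) (l r : R) :
  {in `]0, 1[, forall x, 0 <= g1 x} -> {in `]0, 1[, forall x, 0 <= g2 x} ->
  {in `]0, 1[, continuous g1} -> {in `]0, 1[, continuous g2} ->
  {in `]0, 1[, forall x : R, is_derive x 1 F (g1 x - g2 x)} ->
  F x @[x --> 0^'+] --> l -> F x @[x --> 1^'-] --> r ->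
  (\int[mu]_(x in `]0%R, 1%R[) (g1 x)%:E + l%:E =
   \int[mu]_(x in `]0%R, 1%R[) (g2 x)%:E + r%:E)%E.
Proof.
move=> g10 g20 cg1 cg2 dF Fl Fr.
have mJ n : measurable (J n : set (measurableTypeR R)) by exact: measurable_itv.
have within_cont (g : R -> R) n :
    {in `]0, 1[, continuous g} -> {within J n, continuous g}.
  by move=> cg; apply: continuous_in_subspaceT => x /set_mem /J_sub; exact: cg.
have int_J (g : R -> R) n :
    {in `]0, 1[, continuous g} -> mu.-integrable (J n) (EFin \o g).
  move=> /within_cont cg; apply: continuous_compact_integrable; last exact: cg.
  exact: segment_compact.
have cvg_J (g : R -> R) :
    {in `]0, 1[, continuous g} -> {in `]0, 1[, forall x, 0 <= g x} ->
    (\int[mu]_(x in J n) (g x)%:E @[n --> \oo] -->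
     \int[mu]_(x in `]0%R, 1%R[) (g x)%:E)%E.
  move=> cg g0; rewrite -bigcup_J; apply: ge0_nondecreasing_set_cvg_integral => //.
  - by move=> n; have /integrableP[] := int_J g n cg.
  - by move=> n x /J_sub/g0; rewrite lee_fin.
have cF : {in `]0, 1[, continuous F}.
  move=> x /dF [Fx _]; apply: differentiable_continuous.
  exact/derivable1_diffP.
(* The fundamental theorem of calculus on [J n], arranged without subtraction of integrals: their
   limits may be infinite. *)
have J_FTC n : (\int[mu]_(x in J n) (g1 x)%:E + (F (a n))%:E =
    \int[mu]_(x in J n) (g2 x)%:E + (F (1 - a n))%:E)%E.
  have : (\int[mu]_(x in J n) ((g1 x)%:E - (g2 x)%:E) =
      (F (1 - a n))%:E - (F (a n))%:E)%E.
    rewrite -(@continuous_FTC2 _ (fun x => g1 x - g2 x) F (a n) (1 - a n))//.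
    - by apply: within_cont => x x01; apply: cvgB; [exact: cg1|exact: cg2].
    - split.
      + move=> x xa; have /dF[]// : x \in `]0, 1[.
        by apply: (J_sub (n := n)); exact: subset_itv_oo_cc.
      + apply: cvg_at_right_filter; apply: cF; apply: (J_sub (n := n)).
        by rewrite /J /= in_itv /= lexx ltW.
      + apply: cvg_at_left_filter; apply: cF; apply: (J_sub (n := n)).
        by rewrite /J /= in_itv /= lexx ltW.
    - move=> x xa; have /dF dFx : x \in `]0, 1[.
        by apply: (J_sub (n := n)); exact: subset_itv_oo_cc.
      by rewrite derive1E derive_val.
  rewrite integralB/=; [|exact: mJ|exact: (int_J g1 n cg1)|exact: (int_J g2 n cg2)].
  have /fineK <- := integrable_fin_num (mJ n) (int_J _ n cg1).
  have /fineK <- := integrable_fin_num (mJ n) (int_J _ n cg2).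
  by rewrite -!EFinB -!EFinD => -[?]; congr EFin; lra.
have : (\int[mu]_(x in J n) (g1 x)%:E + (F (a n))%:E @[n --> \oo] -->
    \int[mu]_(x in `]0%R, 1%R[) (g1 x)%:E + l%:E)%E.
  apply: cvgeD; [by rewrite fin_num_adde_defl|exact: cvg_J|].
  by apply/cvg_EFin; [near=> n|move/cvg_at_rightP : Fl; apply].
have : (\int[mu]_(x in J n) (g2 x)%:E + (F (1 - a n))%:E @[n --> \oo] -->
    \int[mu]_(x in `]0%R, 1%R[) (g2 x)%:E + r%:E)%E.
  apply: cvgeD; [by rewrite fin_num_adde_defl|exact: cvg_J|].
  apply/cvg_EFin; [by near=> n|move/cvg_at_leftP : Fr; apply; split].
    by move=> n; rewrite ltrBlDr ltrDl.
  by rewrite -[X in _ --> X]subr0; apply: cvgB => //; exact: cvg_cst.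
under eq_fun do rewrite -J_FTC.
by move=> + h; apply: cvg_unique.
Unshelve. all: by end_near. Qed.

End open_unit_interval.

(** * Finiteness, functional equations and positivity of the beta integral *)

Section beta_function.
Context {R : realType}.
Implicit Types a b p q x : R.
Local Notation mu := (@lebesgue_measure R).

Lemma is_derive_powR_onem b x : x < 1 ->
  is_derive x 1 (fun y => (1 - y) `^ b) (- (b * (1 - x) `^ (b - 1))).
Proof.
move=> x1; have x1' : 0 < 1 - x by rewrite subr_gt0.
have := @is_derive1_comp R (fun y => y `^ b) (fun y => 1 - y) x
  (b * (1 - x) `^ (b - 1)) (-1) (is_derive1_powR _ x1').
rewrite mulrN1; apply.
by rewrite -[-1]sub0r; exact: (is_deriveB (is_derive_cst (1 : R) x 1) (is_derive_id x 1)).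
Qed.

(** For positive [a] and [b] the derivative is a difference of two nonnegative functions, the shape
    that [integral_itvoo_derivative] takes. *)
Lemma is_derive_powR_mul a b x : 0 < x < 1 ->
  is_derive x 1 (fun y => y `^ a * (1 - y) `^ b)
    (a * beta_weight a (b + 1) x - b * beta_weight (a + 1) b x).
Proof.
move=> /andP[x0 x1].
suff -> : a * beta_weight a (b + 1) x - b * beta_weight (a + 1) b x =
    x `^ a *: - (b * (1 - x) `^ (b - 1)) + (1 - x) `^ b *: (a * x `^ (a - 1)).
  exact: is_deriveM (is_derive1_powR a x0) (is_derive_powR_onem b x1).
rewrite /beta_weight !addrK /GRing.scale /=; ring.
Qed.

Lemma continuous_beta_weight a b : {in `]0, 1[, continuous (beta_weight a b)}.
Proof.
move=> x; rewrite in_itv /= => x01.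
have [dx _] := is_derive_powR_mul (a - 1) (b - 1) x01.
exact/differentiable_continuous/derivable1_diffP.
Qed.

Lemma cvg_powR_onem_at_right b : (1 - x) `^ b @[x --> 0^'+] --> (1 : R).
Proof.
suff : (1 - x) `^ b @[x --> 0^'+] --> (1 `^ b : R) by rewrite powR1.
apply: cvg_at_right_filter.
have [d0 _] := is_derive_powR_onem b (@ltr01 R).
have := differentiable_continuous (proj1 (derivable1_diffP _ _) d0).
by rewrite /prop_for /continuous_at /= subr0.
Qed.

Lemma cvg_powR_onem_at_left b : 0 < b -> (1 - x) `^ b @[x --> 1^'-] --> (0 : R).
Proof.
move=> b0; apply/cvg_at_leftP => u [u1 ucvg].
have /cvg_at_rightP := powR_cvg0 b0; apply; split=> [n|].
  by rewrite subr_gt0.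
by rewrite -(subrr (1 : R)); apply: cvgB => //; exact: cvg_cst.
Qed.

Lemma cvg_powR_at_left a : x `^ a @[x --> 1^'-] --> (1 : R).
Proof.
suff : x `^ a @[x --> 1^'-] --> (1 `^ a : R) by rewrite powR1.
apply: cvg_at_left_filter.
have [d1 _] := is_derive1_powR a (@ltr01 R).
exact: differentiable_continuous (proj1 (derivable1_diffP _ _) d1).
Qed.

Lemma measurable_beta_weight (D : set (measurableTypeR R)) a b : measurable D ->
  measurable_fun D (beta_weight a b).
Proof.
move=> mD; apply: measurable_funTS; apply: measurable_funM => //.
apply: (measurableT_comp (measurable_powR _)).
exact: measurable_funB.
Qed.

(** The extended-real value, for which the functional equations make sense before finiteness is
    known. *)
Let I a b : \bar R := (\int[mu]_(x in `]0%R, 1%R[) (beta_weight a b x)%:E)%E.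

Let m01 : measurable (`]0%R, 1%R[ : set (measurableTypeR R)).
Proof. exact: measurable_itv. Qed.

Let I_ge0 a b : (0 <= I a b)%E.
Proof. by apply: integral_ge0 => x _; rewrite lee_fin beta_weight_ge0. Qed.

Let m_weight a b :
  measurable_fun (`]0%R, 1%R[ : set (measurableTypeR R)) (EFin \o beta_weight a b).
Proof. by apply/measurable_EFinP; apply: measurable_beta_weight; exact: m01. Qed.

Lemma exprn_beta_weight a b x n : 0 < x ->
  x ^+ n * beta_weight a b x = beta_weight (a + n%:R) b x.
Proof.
move=> x0; rewrite /beta_weight mulrA -powR_mulrn ?ltW// -powRD; last first.
  by apply/implyP => _; rewrite gt_eqF.
by congr (_ `^ _ * _); ring.
Qed.

(** Multiply the weight by [x + (1 - x) = 1]. *)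
Let I_add a b : I a b = (I (a + 1) b + I a (b + 1))%E.
Proof.
rewrite /I -ge0_integralD//=; last 4 first.
- by move=> x _; rewrite lee_fin beta_weight_ge0.
- exact: m_weight.
- by move=> x _; rewrite lee_fin beta_weight_ge0.
- exact: m_weight.
apply: eq_integral => x /set_mem; rewrite /= in_itv /= => /andP[x0 x1].
have x1' : 0 < 1 - x by rewrite subr_gt0.
have powS (y c : R) : 0 < y -> y `^ c = y * y `^ (c - 1).
  move=> y0; rewrite -[X in X * _]powRr1 ?ltW// -powRD; first by rewrite addrC subrK.
  by apply/implyP => _; rewrite gt_eqF.
rewrite -EFinD; congr EFin; rewrite /beta_weight !addrK.
rewrite (powS x a)// (powS (1 - x) b)//; ring.
Qed.

(** Integration by parts: the primitive [x ^ a * (1 - x) ^ b] vanishes at both ends. *)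
Let I_swap a b : 0 < a -> 0 < b -> (a%:E * I a (b + 1) = b%:E * I (a + 1) b)%E.
Proof.
move=> a0 b0; rewrite /I -!ge0_integralZl//=; last 6 first.
- exact: m_weight.
- by move=> x _; rewrite lee_fin beta_weight_ge0.
- by rewrite lee_fin ltW.
- exact: m_weight.
- by move=> x _; rewrite lee_fin beta_weight_ge0.
- by rewrite lee_fin ltW.
have cZ (c : R) a' b' : {in `]0, 1[, continuous (fun x => c * beta_weight a' b' x)}.
  by move=> x x01; apply: cvgM; [exact: cvg_cst|exact: continuous_beta_weight].
have := @integral_itvoo_derivative R (fun x => a * beta_weight a (b + 1) x)
  (fun x => b * beta_weight (a + 1) b x) (fun x => x `^ a * (1 - x) `^ b) 0 0.
rewrite !adde0; apply => //.
- by move=> x _; rewrite mulr_ge0 ?beta_weight_ge0// ltW.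
- by move=> x _; rewrite mulr_ge0 ?beta_weight_ge0// ltW.
- by move=> x; rewrite in_itv; exact: is_derive_powR_mul.
- rewrite -[X in _ --> X](mul0r 1).
  by apply: cvgM; [exact: powR_cvg0|exact: cvg_powR_onem_at_right].
- rewrite -[X in _ --> X](mulr0 1).
  by apply: cvgM; [exact: cvg_powR_at_left|exact: cvg_powR_onem_at_left].
Qed.

(** The primitive [- b^-1 * (1 - x) ^ b] goes from [- b^-1] to [0]. *)
Let I1 b : 0 < b -> I 1 b = (b^-1)%:E.
Proof.
move=> b0.
have := @integral_itvoo_derivative R (beta_weight 1 b) (fun=> 0)
  (fun x => - b^-1 * (1 - x) `^ b) (- b^-1) 0.
rewrite integral0 adde0 => h.
rewrite -[LHS](@addeK _ (- b^-1)%:E)// h ?sub0e ?EFinN ?oppeK//.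
- by move=> x _; exact: beta_weight_ge0.
- exact: continuous_beta_weight.
- by move=> x _; exact: cvg_cst.
- move=> x; rewrite in_itv /= => /andP[x0 x1].
  suff -> : beta_weight 1 b x - 0 = - b^-1 * - (b * (1 - x) `^ (b - 1)).
    exact: is_deriveZ (is_derive_powR_onem b x1).
  by rewrite /beta_weight subrr powRr0 mulrNN mulrA mulVf ?gt_eqF// subr0.
- rewrite -[X in _ --> X]mulr1.
  by apply: cvgM; [exact: cvg_cst|exact: cvg_powR_onem_at_right].
- rewrite -[X in _ --> X](mulr0 (- b^-1)).
  by apply: cvgM; [exact: cvg_cst|exact: cvg_powR_onem_at_left].
Qed.

(** As [x ^ a <= 1], the integral [I (a + 1) b] is at most [I 1 b]. By [I_swap] then [I a (b + 1)]
    is finite too, and [I_add] sums the two. *)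
Let I_lty a b : 0 < a -> 0 < b -> (I a b < +oo)%E.
Proof.
move=> a0 b0; have IS : (I (a + 1) b < +oo)%E.
  apply: (@le_lt_trans _ _ (I 1 b)); last by rewrite I1// ltry.
  apply: ge0_le_integral => //.
  - by move=> x _; rewrite lee_fin beta_weight_ge0.
  - exact: m_weight.
  - exact: m_weight.
  - move=> x; rewrite /= in_itv /= => /andP[x0 x1].
    rewrite lee_fin /beta_weight ler_wpM2r ?powR_ge0//.
    by apply: ger_powR; [rewrite x0 ltW|rewrite lerB// lerDr ltW].
rewrite I_add lte_add_pinfty//.
have /(congr1 (fun y => (a^-1)%:E * y)%E) := I_swap a0 b0.
rewrite !muleA -!EFinM mulVf ?gt_eqF// mul1e => ->.
by rewrite lte_mul_pinfty// lee_fin mulr_ge0 ?invr_ge0 ?ltW.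
Qed.

Lemma integrable_beta_weight a b : 0 < a -> 0 < b ->
  mu.-integrable `]0, 1[ (EFin \o beta_weight a b).
Proof.
move=> a0 b0; apply/integrableP; split; first exact: m_weight.
under eq_integral do rewrite /= ger0_norm ?beta_weight_ge0//.
exact: I_lty.
Qed.

Lemma EFin_euler_beta a b : 0 < a -> 0 < b ->
  (euler_beta a b)%:E = (\int[mu]_(x in `]0%R, 1%R[) (beta_weight a b x)%:E)%E.
Proof. by move=> a0 b0; rewrite fineK// ge0_fin_numE ?(I_lty a0 b0)//; exact: I_ge0. Qed.

Lemma euler_beta1 b : 0 < b -> euler_beta 1 b = b^-1.
Proof. by move=> b0; apply: EFin_inj; rewrite EFin_euler_beta//; exact: I1. Qed.

Lemma euler_beta_add a b : 0 < a -> 0 < b ->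
  euler_beta a b = euler_beta (a + 1) b + euler_beta a (b + 1).
Proof.
move=> a0 b0; apply: EFin_inj; rewrite EFinD !EFin_euler_beta ?addr_gt0//.
exact: I_add.
Qed.

Lemma euler_betaS a b : 0 < a -> 0 < b ->
  euler_beta (a + 1) b = a / (a + b) * euler_beta a b.
Proof.
move=> a0 b0; have : a * euler_beta a (b + 1) = b * euler_beta (a + 1) b.
  by apply: EFin_inj; rewrite !EFinM !EFin_euler_beta ?addr_gt0//; exact: I_swap.
have ab0 : a + b != 0 by rewrite gt_eqF ?addr_gt0.
have -> : euler_beta a (b + 1) = euler_beta a b - euler_beta (a + 1) b.
  by rewrite (euler_beta_add a0 b0) addrAC subrr add0r.
by move=> h; apply: (mulfI ab0); rewrite mulrA mulrCA divff// mulr1; lra.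
Qed.

(** The index type is arbitrary so that ordinals give polynomials and pairs give the expanded square
    of a polynomial. *)
Lemma integrable_sum_monomials (J : finType) (c : J -> R) (n : J -> nat) a b :
  0 < a -> 0 < b ->
  mu.-integrable `]0, 1[
    (EFin \o (fun x => (\sum_j c j * x ^+ n j) * beta_weight a b x)).
Proof.
move=> a0 b0.
apply: (@eq_integrable _ _ _ _ _ m01
    (fun x => \sum_j (c j)%:E * (beta_weight (a + (n j)%:R) b x)%:E)%E).
  move=> x /set_mem; rewrite /= in_itv /= => /andP[x0 _].
  rewrite mulr_suml -sumEFin; apply: eq_bigr => j _.
  by rewrite -EFinM -mulrA exprn_beta_weight.
apply: integrable_sum => // j _; apply: integrableZl => //.
by apply: integrable_beta_weight; rewrite ?ltr_wpDr.
Qed.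

Lemma Rintegral_sum_monomials (J : finType) (c : J -> R) (n : J -> nat) a b :
  0 < a -> 0 < b ->
  \int[mu]_(x in `]0, 1[) ((\sum_j c j * x ^+ n j) * beta_weight a b x) =
  \sum_j c j * euler_beta (a + (n j)%:R) b.
Proof.
move=> a0 b0; rewrite /Rintegral.
have iw j : mu.-integrable `]0, 1[ (EFin \o beta_weight (a + (n j)%:R) b).
  by apply: integrable_beta_weight; rewrite ?ltr_wpDr.
transitivity (fine (\int[mu]_(x in `]0%R, 1%R[)
    \sum_j (c j)%:E * (beta_weight (a + (n j)%:R) b x)%:E)%E).
  congr fine; apply: eq_integral => x /set_mem; rewrite /= in_itv /= => /andP[x0 _].
  rewrite mulr_suml -sumEFin; apply: eq_bigr => j _.
  by rewrite -EFinM -mulrA exprn_beta_weight.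
rewrite (integral_sum m01); last by move=> j; exact: (integrableZl m01 _ (iw j)).
under eq_bigr => j _.
  rewrite (integralZl m01 (iw j)).
  rewrite -EFin_euler_beta ?ltr_wpDr// -EFinM; over.
by rewrite sumEFin.
Qed.

(** If the integral were 0, the integrand would vanish almost everywhere. Since the weight is
    positive and [f] has finitely many roots, the interval itself would be negligible. *)
Lemma Rintegral_sqr_horner_beta_weight_gt0 (f : {poly R}) a b :
  mu.-integrable `]0, 1[ (EFin \o (fun x => f.[x] ^+ 2 * beta_weight a b x)) ->
  f != 0 ->
  0 < \int[mu]_(x in `]0, 1[) (f.[x] ^+ 2 * beta_weight a b x).
Proof.
move=> intf f0; pose g x := f.[x] ^+ 2 * beta_weight a b x.
have g0 x : 0 <= g x by rewrite mulr_ge0 ?sqr_ge0 ?beta_weight_ge0.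
rewrite lt_neqAle; apply/andP; split; last by apply: Rintegral_ge0 => x _; exact: g0.
apply/eqP => int0.
have : (\int[mu]_(x in `]0%R, 1%R[) `|(g x)%:E| = 0)%E.
  under eq_integral do rewrite gee0_abs ?lee_fin ?g0//.
  rewrite -(fineK (integrable_fin_num m01 intf)).
  by rewrite -[fine _]/(\int[mu]_(x in `]0, 1[) g x) -int0.
have /integrableP[mg _] := intf.
move=> /(ae_eq_integral_abs mu m01 mg)[N [mN N0 subN]].
have rootsC : countable [set x | root f x].
  apply: finite_set_countable; apply: contrapT => /(infinite_set_fset (size f))[B Bf].
  rewrite leqNgt => /negP; apply; apply: max_poly_roots f0 _ (finmap.fset_uniq B).
  by apply/allP => x /Bf.
have Zneg : mu.-negligible [set x | root f x].
  apply/negligibleP; last exact: countable_lebesgue_measure0.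
  exact: countable_measurable.
have Nneg : mu.-negligible N by exact/(negligibleP mu mN).
have : mu.-negligible `]0, 1[.
  apply: negligibleS (negligibleU Nneg Zneg) => x x01.
  have [|fx] := boolP (root f x); [by right|left].
  apply: subN => /= /(_ x01) /eqP; rewrite eqe; apply/negP.
  move: x01; rewrite /= in_itv /= => /andP[x0 x1].
  rewrite mulf_neq0 ?sqrf_eq0// /beta_weight mulf_neq0// gt_eqF// powR_gt0//.
  by rewrite subr_gt0.
move=> /(negligibleP mu m01) mu0; have := @lebesgue_measure_itv R `]0, 1[.
rewrite [LHS]mu0 /= lte_fin ltr01 oppr0 adde0 => /eqP.
by rewrite eqe eq_sym oner_eq0.
Qed.

End beta_function.

(** * The beta distribution *)

Section density.
Import HBNNSimple.
Context d (T : measurableType d) (R : realType).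
Variables (mu nu : {measure set T -> \bar R}) (g : T -> R).
Hypotheses (g0 : forall x, 0 <= g x) (mg : measurable_fun setT g).
Hypothesis nuE : forall A, measurable A -> nu A = (\int[mu]_(x in A) (g x)%:E)%E.

Let nnsfun_integral_density (h : {nnsfun T >-> R}) :
  (\int[nu]_x (h x)%:E = \int[mu]_x ((h x)%:E * (g x)%:E))%E.
Proof.
have mh r : measurable (h @^-1` [set r]) by exact: measurable_funPTI.
have mgE : measurable_fun setT (EFin \o g) by exact/measurable_EFinP.
have h0 r : r \in range h -> 0 <= r by rewrite inE => -[t _ <-].
rewrite integralT_nnsfun sintegralE.
transitivity (\int[mu]_x
    (\sum_(y \in range h) (y * \1_(h @^-1` [set y]) x)%:E * (g x)%:E))%E; last first.
  apply: eq_integral => x _; rewrite [in RHS](fimfunE h x) -fsumEFin//.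
  by rewrite ge0_mule_fsuml// => y; exact: nnfun_muleindic_ge0.
rewrite ge0_integral_fsum//; last 2 first.
- move=> y; apply: emeasurable_funM => //; apply/measurable_EFinP.
  exact: measurable_funM.
- by move=> y x _; rewrite mule_ge0 ?lee_fin// -lee_fin nnfun_muleindic_ge0.
apply: eq_fsbigr => r /h0 r0; rewrite nuE// integral_mkcond.
rewrite -ge0_integralZl//; last 2 first.
- exact/(measurable_restrictT _ (mh r))/measurable_funTS.
- by move=> x _; apply: erestrict_ge0 => y _; rewrite lee_fin.
by apply: eq_integral => x _; rewrite EFinM epatch_indic muleAC muleA.
Qed.

Let ge0_integral_density (f : T -> \bar R) : measurable_fun setT f ->
  (forall x, 0 <= f x)%E -> (\int[nu]_x f x = \int[mu]_x (f x * (g x)%:E))%E.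
Proof.
move=> mf f0; pose h := nnsfun_approx measurableT mf.
have fE x : f x = lim (EFin (h n x) @[n --> \oo]).
  by apply/esym/cvg_lim => //; exact: cvg_nnsfun_approx.
transitivity (lim (\int[nu]_x (h n x)%:E @[n --> \oo])%E).
  under eq_integral do rewrite fE.
  apply: monotone_convergence => //.
  - by move=> n; exact/measurable_EFinP.
  - by move=> n x _; rewrite lee_fin.
  - by move=> x _ i j ij; rewrite lee_fin; exact/lefP/nd_nnsfun_approx.
transitivity (lim (\int[mu]_x ((h n x)%:E * (g x)%:E) @[n --> \oo])%E).
  by under eq_fun do rewrite nnsfun_integral_density.
rewrite -monotone_convergence//.
- apply: eq_integral => x _; apply/cvg_lim => //; apply: cvgeZr => //.
  exact: cvg_nnsfun_approx.
- by move=> n; apply: emeasurable_funM; exact/measurable_EFinP.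
- by move=> n x _; rewrite mule_ge0 ?lee_fin.
- by move=> x _ i j ij; rewrite lee_wpmul2r ?lee_fin//; exact/lefP/nd_nnsfun_approx.
Qed.

(** From simple functions to nonnegative ones by monotone convergence, then to all by positive and
    negative parts, with which multiplication by [g x >= 0] commutes. *)
Lemma integral_density (f : T -> \bar R) : measurable_fun setT f ->
  (\int[nu]_x f x = \int[mu]_x (f x * (g x)%:E))%E.
Proof.
move=> mf; rewrite integralE [RHS]integralE.
rewrite !ge0_integral_density//; [|exact: measurable_funeneg|exact: measurable_funepos].
congr (_ - _)%E; apply: eq_integral => x _.
- by rewrite !funeposE maxe_pMl ?mul0e// lee_fin.
- by rewrite !funenegE maxe_pMl ?mulNe ?mul0e// lee_fin.
Qed.
End density.

(** * The reflection [x -> 1 - x] and integrals against the beta distribution *)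

Section beta_distribution.
Context {R : realType}.
Implicit Types (p q x : R) (A : set (measurableTypeR R)).
Local Notation mu := (@lebesgue_measure R).

Let onem (x : measurableTypeR R) : measurableTypeR R := 1 - x.

Let measurable_onem : measurable_fun setT onem.
Proof. exact: measurable_funB. Qed.

Let onem_mfun : {mfun measurableTypeR R >-> measurableTypeR R} :=
  HB.pack onem (isMeasurableFun.Build _ _ _ _ _ measurable_onem).

(** By uniqueness of Lebesgue measure it suffices to compare on []a, b]], whose preimage [[1 - b, 1
    - a[] has the same length. *)
Lemma lebesgue_measure_onem A : measurable A -> mu ((fun x => 1 - x) @^-1` A) = mu A.
Proof.
move=> mA; apply/esym.
rewrite (@lebesgue_measure_unique R (pushforward mu onem_mfun))// => _ [[a b]] _ <-.
have preE : onem @^-1` `]a, b] = `[1 - b, 1 - a[%classic.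
  by apply/seteqP; split=> x; rewrite /onem /= !in_itv /=; lra.
rewrite -[RHS]/(mu (onem @^-1` `]a, b])) preE !lebesgue_measure_itv /=.
rewrite !lte_fin ltrD2l ltrN2.
by case: ifP => // _; congr EFin; ring.
Qed.

Lemma ge0_integral_onem A (f : R -> \bar R) : measurable A -> measurable_fun A f ->
  (forall x, A x -> (0 <= f x)%E) ->
  (\int[mu]_(x in (fun x => 1 - x)%R @^-1` A) f (1 - x)%R = \int[mu]_(x in A) f x)%E.
Proof.
move=> mA mf f0.
rewrite -(ge0_integral_pushforward measurable_onem mu mA mf); last first.
  by move=> x /set_mem; exact: f0.
apply: eq_measure_integral => B mB _; exact: lebesgue_measure_onem.
Qed.

Lemma preimage_onem_itv01 : (fun x => 1 - x) @^-1` `]0, 1[ = `]0, 1[%classic.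
Proof. by apply/seteqP; split=> x; rewrite /= !in_itv /=; lra. Qed.

Lemma beta_weight_onem p q x : beta_weight p q (1 - x) = beta_weight q p x.
Proof. by rewrite /beta_weight subKr mulrC. Qed.

Lemma euler_betaC p q : euler_beta p q = euler_beta q p.
Proof.
congr fine; rewrite -[LHS]ge0_integral_onem.
- by rewrite preimage_onem_itv01; apply: eq_integral => x _; rewrite beta_weight_onem.
- exact: measurable_itv.
- apply/measurable_EFinP; apply: measurable_beta_weight; exact: measurable_itv.
- by move=> x _; rewrite lee_fin beta_weight_ge0.
Qed.

Lemma beta_density_onem p q x : beta_density p q (1 - x) = beta_density q p x.
Proof.
rewrite /beta_density euler_betaC; congr (_ / _); rewrite !patchE.
have -> : (1 - x \in `]0, 1[%classic) = (x \in `]0, 1[%classic).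
  by apply/idP/idP => /set_mem h; apply/mem_set; move: h; rewrite /= !in_itv /=; lra.
by rewrite beta_weight_onem.
Qed.

Lemma beta_dist_onem p q A : measurable A ->
  beta_dist p q ((fun x => 1 - x) @^-1` A) = beta_dist q p A.
Proof.
move=> mA.
have mdens : measurable_fun A (EFin \o beta_density q p).
  apply/measurable_EFinP; apply: measurable_funTS.
  exact: measurable_beta_density.
have dens0 x : A x -> (0 <= (EFin \o beta_density q p) x)%E.
  by move=> _; rewrite lee_fin beta_density_ge0.
apply: etrans (ge0_integral_onem mA mdens dens0).
by apply: eq_integral => x _ /=; rewrite beta_density_onem.
Qed.

Lemma Rintegral_beta_dist p q (f : R -> R) : measurable_fun setT f ->
  mu.-integrable `]0, 1[ (EFin \o (fun x => f x * beta_weight p q x)) ->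
  \int[beta_dist p q]_x f x =
  (euler_beta p q)^-1 * \int[mu]_(x in `]0, 1[) (f x * beta_weight p q x).
Proof.
move=> mf intf; rewrite /Rintegral.
rewrite (integral_density (g := beta_density p q) (mu := mu))//; last 3 first.
- exact: beta_density_ge0.
- exact: measurable_beta_density.
- exact/measurable_EFinP.
have m01 : measurable (`]0%R, 1%R[ : set (measurableTypeR R)) by exact: measurable_itv.
rewrite -[RHS](RintegralZl _ m01 intf).
rewrite [in RHS]/Rintegral [in RHS]integral_mkcond; congr fine.
apply: eq_integral => x _; rewrite patchE /beta_density patchE.
case: ifPn => _; last by rewrite mul0r mule0.
by rewrite -EFinM; congr EFin; ring.
Qed.
End beta_distribution.

(** * Moments of the beta distribution and the limiting matrix *)

Section beta_moments.
Context {R : realType}.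
Implicit Types (p q x : R).
Local Notation mu := (@lebesgue_measure R).

Lemma euler_beta_gt0 p q : 0 < p -> 0 < q -> 0 < euler_beta p q.
Proof.
move=> p0 q0; have wE : beta_weight p q =
    fun x => (1 : {poly R}).[x] ^+ 2 * beta_weight p q x.
  by apply/funext => x; rewrite -polyC1 hornerC expr1n mul1r.
rewrite /euler_beta wE.
apply: Rintegral_sqr_horner_beta_weight_gt0; last exact: oner_neq0.
by rewrite -wE; exact: integrable_beta_weight.
Qed.

Lemma euler_beta_addn p q n : 0 < p -> 0 < q ->
  euler_beta (p + n%:R) q =
  (\prod_(k < n) ((p + k%:R) / (p + k%:R + q))) * euler_beta p q.
Proof.
move=> p0 q0; elim: n => [|n IH]; first by rewrite big_ord0 mul1r addr0.
rewrite big_ord_recr /= mulrAC -IH mulrC -natr1 addrA euler_betaS//.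
by rewrite ltr_wpDr.
Qed.

Lemma beta_moment p q n : 0 < p -> 0 < q ->
  moment (beta_dist p q) n = euler_beta (p + n%:R) q / euler_beta p q.
Proof.
move=> p0 q0; rewrite mulrC.
have := Rintegral_sum_monomials (fun _ : 'I_1 => 1) (fun=> n) p0 q0.
have := integrable_sum_monomials (fun _ : 'I_1 => 1) (fun=> n) p0 q0.
rewrite big_ord1 mul1r.
have -> : (fun x => (\sum_(j < 1) 1 * x ^+ n) * beta_weight p q x) =
    (fun x => x ^+ n * beta_weight p q x).
  by apply/funext => x; rewrite big_ord1 mul1r.
by move=> int_n <-; rewrite -Rintegral_beta_dist.
Qed.

Lemma beta_moment0 p q : 0 < p -> 0 < q -> moment (beta_dist p q) 0 = 1.
Proof. by move=> p0 q0; rewrite beta_moment// addr0 divff// gt_eqF// euler_beta_gt0. Qed.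

(** After swapping the parameters, [(1 - x) ^+ n] is expanded under the weight of [beta_dist q p].
    This is the moment identity that [free_cumulant_onem] takes. *)
Lemma beta_moment_onem p q n : 0 < p -> 0 < q ->
  moment (beta_dist p q) n =
  \sum_(j < n.+1) ((-1) ^+ (n - j) * moment (beta_dist q p) (n - j)%N) *+ 'C(n, j).
Proof.
move=> p0 q0; apply: (etrans (beta_moment n p0 q0)).
rewrite (euler_betaC (p + _)) (euler_betaC p).
transitivity ((\sum_(j < n.+1) ((-1) ^+ (n - j) *+ 'C(n, j)) *
    euler_beta (q + (n - j)%:R) p)
  / euler_beta q p); last first.
  rewrite mulr_suml; apply: eq_bigr => j _.
  by rewrite (beta_moment _ q0 p0) mulrnAl mulrnAl mulrA.
congr (_ / _); rewrite -Rintegral_sum_monomials//.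
apply: eq_Rintegral => x /set_mem; rewrite /= in_itv /= => /andP[x0 x1].
rewrite -beta_weight_onem -exprn_beta_weight ?subr_gt0// beta_weight_onem; congr (_ * _).
rewrite addrC exprDn; apply: eq_bigr => j _.
by rewrite expr1n mulr1 mulrnAl -exprMn mulN1r.
Qed.

Lemma cvg_beta_moment_scaled p n : 0 < p -> (0 < n)%N ->
  q^-1 * moment (beta_dist q p) n @[q --> 0^'+] --> euler_beta n%:R p.
Proof.
move=> p0; case: n => // n _.
(* The moment is a product of ratios whose first factor is [q / (q + p)]; its numerator cancels
   [q^-1] and leaves an expression continuous at 0. *)
have qE : {near 0^'+, (fun q => (q + p)^-1 *
      \prod_(k < n) ((q + k.+1%:R) / (q + k.+1%:R + p))) =1
    (fun q => q^-1 * moment (beta_dist q p) n.+1)}.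
  near=> q; have q0 : 0 < q by [].
  rewrite (beta_moment _ q0 p0) (euler_beta_addn _ q0 p0) mulfK ?gt_eqF ?euler_beta_gt0//.
  by rewrite big_ord_recl /= addr0 !mulrA mulVf ?gt_eqF// mul1r.
apply: cvg_trans (near_eq_cvg qE) _.
(* The same recursion started at [euler_beta 1 p = p^-1] writes the limit as that expression at
   [q = 0]. *)
rewrite -nat1r euler_beta_addn// euler_beta1// mulrC.
have cvgq (c : R) : q + c @[q --> 0^'+] --> c.
  rewrite -[X in _ --> X]add0r; apply: cvgD; last exact: cvg_cst.
  by apply: (@cvg_at_right_filter _ _ id); exact: cvg_id.
apply: cvgM; first by apply: cvgV; [rewrite gt_eqF|exact: cvgq].
apply: cvg_big => [|k _]; first exact: mul_continuous.
rewrite nat1r; apply: cvgM; first exact: cvgq.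
apply: cvgV; first by rewrite gt_eqF// addr_gt0.
by under eq_fun do rewrite -addrA; exact: cvgq.
Unshelve. all: by end_near. Qed.

Lemma posdefmx_euler_beta p N : 0 < p ->
  posdefmx (\matrix_(i < N.+1, j < N.+1) euler_beta (i + j + 2)%:R p).
Proof.
move=> p0; split=> [|v v0].
  by apply/matrixP => i j; rewrite !mxE [(j + i)%N]addnC.
(* The quadratic form at [v] is the integral of the square of [f] against [beta_weight 2 p]; the
   first parameter 2 is the shift in [i + j + 2]. *)
pose f := \poly_(i < N.+1) v (inord i) 0.
have f_neq0 : f != 0.
  apply: contraNneq v0 => f0; apply/eqP/matrixP => i j; rewrite mxE [j]ord1.
  have := congr1 (fun g : {poly R} => g`_i) f0.
  by rewrite coef_poly coef0 ltn_ord inord_val.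
have fE x : f.[x] ^+ 2 =
    \sum_(ij : 'I_N.+1 * 'I_N.+1) (v ij.1 0 * v ij.2 0) * x ^+ (ij.1 + ij.2).
  rewrite horner_poly expr2 big_distrlr/= pair_bigA /=; apply: eq_bigr => -[i j] _ /=.
  by rewrite !inord_val exprD mulrACA.
have wE : (fun x => f.[x] ^+ 2 * beta_weight 2 p x) = fun x =>
    (\sum_(ij : 'I_N.+1 * 'I_N.+1) (v ij.1 0 * v ij.2 0) * x ^+ (ij.1 + ij.2)) *
    beta_weight 2 p x.
  by apply/funext => x; rewrite fE.
have ltr02 : 0 < 2 :> R by [].
have := @Rintegral_sqr_horner_beta_weight_gt0 R f 2 p.
rewrite wE => /(_ (integrable_sum_monomials _ _ ltr02 p0) f_neq0).
rewrite Rintegral_sum_monomials// quad_formE pair_bigA /= => h.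
apply: etrans h; congr (0 < _); apply: eq_bigr => -[i j] _ /=.
by rewrite mxE addnC natrD mulrAC.
Qed.
End beta_moments.

(** * Hankel matrices of free cumulants *)

Lemma eq_free_cumulant (R : realType)
    (mu nu : {measure set (measurableTypeR R) -> \bar R}) :
  (forall A, measurable A -> mu A = nu A) -> free_cumulant mu = free_cumulant nu.
Proof.
move=> munu; suff E : moment mu = moment nu by rewrite /free_cumulant E.
apply/funext => n; congr fine; apply: eq_measure_integral => A mA _.
exact: munu.
Qed.

(** Since [(-1) ^+ (i + j + 2)] factors as [(-1) ^+ i * (-1) ^+ j], replacing [v] by [w] turns one
    quadratic form into the other. Only orders at least 2 enter the matrices. *)
Lemma posdefmx_hankel_sign (R : realType) (k k' : nat -> R) N :
  (forall n, (1 < n)%N -> k' n = (-1) ^+ n * k n) ->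
  posdefmx (\matrix_(i < N.+1, j < N.+1) k (i + j + 2)%N) ->
  posdefmx (\matrix_(i < N.+1, j < N.+1) k' (i + j + 2)%N).
Proof.
move=> k'E [_ Hpos]; split=> [|v v0].
  by apply/matrixP => i j; rewrite !mxE [(j + i)%N]addnC.
pose w : 'cV[R]_N.+1 := \col_i ((-1) ^+ i * v i 0).
have w0 : w != 0.
  apply: contraNneq v0 => w0; apply/eqP/matrixP => i j; rewrite mxE [j]ord1.
  have /matrixP/(_ i 0) := w0; rewrite !mxE => /eqP.
  by rewrite mulf_eq0 signr_eq0 => /eqP.
have := Hpos _ w0; rewrite !quad_formE => h; apply: etrans h; congr (0 < _).
apply: eq_bigr => i _; apply: eq_bigr => j _; rewrite !mxE k'E ?addn2//.
by rewrite !exprS exprD; ring.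
Qed.

Lemma posdefmx_cumulant_hankel_onem (R : realType) (p q : R) N : 0 < p -> 0 < q ->
  posdefmx (cumulant_hankel N (beta_dist q p)) ->
  posdefmx (cumulant_hankel N (beta_dist p q)).
Proof.
move=> p0 q0; apply: posdefmx_hankel_sign => n n1.
apply: free_cumulant_onem n1; first exact: beta_moment0.
by move=> i; exact: beta_moment_onem.
Qed.

Theorem propositionB2 (R : realType) (p : R) (p_gt0 : 0 < p)
    (d : R -> measure_display) (T : forall q, measurableType (d q))
    (P : forall q, probability (T q) R)
    (X Y : forall q, {RV P q >-> measurableTypeR R})
    (X_beta : forall q, 0 < q -> forall A, measurable A ->
       distribution (P q) (X q) A = beta_dist p q A)
    (Y_def : forall q, 0 < q -> forall w, Y q w = 1 - X q w)
    (N : nat) :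
  [/\ forall q, 0 < q -> forall A, measurable A ->
        distribution (P q) (Y q) A = beta_dist q p A,
      forall i j : 'I_N.+1,
        (q^-1 *: cumulant_hankel N (distribution (P q) (Y q))) i j @[q --> 0^'+]
          --> euler_beta (i + j + 2)%:R p,
      posdefmx (\matrix_(i < N.+1, j < N.+1) euler_beta (i + j + 2)%:R p) &
      \forall q \near 0^'+, posdefmx (cumulant_hankel N (beta_dist p q))].
Proof.
have Y_beta q : 0 < q -> forall A, measurable A ->
    distribution (P q) (Y q) A = beta_dist q p A.
  move=> q0 A mA; rewrite -beta_dist_onem// -X_beta//; last first.
    by rewrite -[_ @^-1` _]setTI; apply: measurable_funB.
  rewrite /distribution /pushforward; congr (P q _).
  by apply/seteqP; split=> w; rewrite /= Y_def.
have cvg_beta i j : (q^-1 *: cumulant_hankel N (beta_dist q p)) i j @[q --> 0^'+]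
    --> euler_beta (i + j + 2)%:R p.
  under eq_fun do rewrite !mxE.
  apply: (@cvg_free_cumulant_scaled _ (fun q => moment (beta_dist q p))
    (fun q => free_cumulant (beta_dist q p)) (fun n => euler_beta n%:R p)).
  - by move=> q _; exact: moment_free_cumulant.
  - by move=> n; exact: cvg_beta_moment_scaled.
  - by rewrite addn2.
split=> //; first last.
(* Positive definiteness holds first for the rescaled matrix of [beta_dist q p]; then the factor
   [q^-1] is removed and the reflection leads to [beta_dist p q]. *)
- have := @near_posdefmx _ _ _ (0^'+ : set_system R) _
    (fun q => q^-1 *: cumulant_hankel N (beta_dist q p)) _ _
    (posdefmx_euler_beta N p_gt0) _.
  move=> h; have {}h : \forall q \near 0^'+,
      posdefmx (q^-1 *: cumulant_hankel N (beta_dist q p)).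
    apply: h => [i j|]; first by rewrite mxE; exact: cvg_beta.
    by near=> q; apply/matrixP => i j; rewrite !mxE [(j + i)%N]addnC.
  near=> q; have q0 : 0 < q by [].
  apply: posdefmx_cumulant_hankel_onem => //.
  have : posdefmx (q^-1 *: cumulant_hankel N (beta_dist q p)) by near: q.
  by move=> /(posdefmxZ q0); rewrite scalerA divff ?gt_eqF// scale1r.
- exact: posdefmx_euler_beta.
(* The law of [Y q] agrees with [beta_dist q p] for [q > 0] and on measurable sets, which determines
   the cumulants near [0^'+]. *)
- move=> i j; apply: cvg_trans (cvg_beta i j); apply: near_eq_cvg; near=> q.
  by rewrite !mxE (eq_free_cumulant (Y_beta q _)).
Unshelve. all: by end_near. Qed.
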